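(* Suppose there are a constant $c$ and a function $d(n,m)$ with $\lim_{m\to\infty} d(n,m)/m=0$ for every fixed $n$, such that for every $n$, every initial BST $T_0$ on $\{1,\dots,n\}$ and every query sequence $X\in[n]^m$, $$\mathrm{cost}(GF,X,T_0)\le c\cdot \mathrm{cost}(OPT,X,T_0)+d(n,m).$$ Then $c\ge 2$.
   Context: Binary search tree model. Keys are $\{1,\dots,n\}$. A query sequence is $X=[x_1,\dots,x_m]\in[n]^m$ and $T_0$ is an initial binary search tree (BST) on the keys. An algorithm $A$ serves $x_1,\dots,x_m$ in order. Before serving $x_t$ it holds a BST $T_{t-1}$; it searches $x_t$ from the root and may then restructure the tree by rotations into $T_t$. Let $P_t$ be the set of nodes on the root-to-$x_t$ path of $T_{t-1}$, and let $U_t$ be the node set of the minimal subtree containing all edges rotated in transforming $T_{t-1}$ into $T_t$. The cost at time $t$ is $|P_t\cup U_t|$. $\mathrm{cost}(A,X,T_0)$ is the sum of these costs over $t=1,\dots,m$, and $\hat c(A,X,T_0)=\mathrm{cost}(A,X,T_0)/m$. $OPT$ denotes an algorithm of minimum cost on $(X,T_0)$ that knows all of $X$ in advance. Greedy Future ($GF$). After finding $x_t$ in $T_{t-1}$, let $v_1<\dots<v_k$ be the keys on the root-to-$x_t$ path, set $v_0=-\infty$ and $v_{k+1}=+\infty$, and let $R_0,\dots,R_k$ be the subtrees hanging off this path. For each $i$, $\tau(v_i)$ is the smallest $s>t$ with $x_s\in(v_{i-1},v_{i+1})$, or $+\infty$ if there is none. $GF$ rearranges $v_1,\dots,v_k$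 as a treap: a BST in key order and a heap in $\tau$, with the smallest $\tau$ at the top. Ties in $\tau$ are broken in favor of the node of smaller depth in $T_{t-1}$. It then reattaches $R_0,\dots,R_k$ unchanged at their unique positions, giving $T_t$. *)

(* Defs.v *)
From mathcomp Require Import all_boot.
From Stdlib Require Import Reals.

Set Implicit Arguments.
Unset Strict Implicit.
Unset Printing Implicit Defensive.

Inductive tree := Leaf | Node of tree & nat & tree.

Fixpoint inorder (T : tree) : seq nat :=
  match T with Leaf => [::] | Node l k r => inorder l ++ k :: inorder r end.

Definition is_bst_on (n : nat) (T : tree) : Prop := inorder T = iota 1 n.

Fixpoint path (T : tree) (x : nat) : seq nat :=
  match T with
  | Leaf => [::]
  | Node l k r => k :: (if x < k then path l x else if k < x then path r x else [::])
  end.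

Fixpoint rot (c : nat) (T : tree) : option tree :=
  match T with
  | Leaf => None
  | Node l k r =>
    if c < k then
      match l with
      | Node a lk b =>
        if lk == c then Some (Node a lk (Node b k r))
        else omap (fun l' => Node l' k r) (rot c l)
      | Leaf => None
      end
    else if k < c then
      match r with
      | Node a rk b =>
        if rk == c then Some (Node (Node l k a) rk b)
        else omap (fun r' => Node l k r') (rot c r)
      | Leaf => None
      end
    else None
  end.

(* parent key of c in T (meaningful when c is a non-root node) *)
Definition parent (T : tree) (c : nat) : nat := nth 0 (path T c) (size (path T c)).-2.

Fixpoint run_rots (T : tree) (rs : seq nat) : option (tree * seq nat) :=
  match rs with
  | [::] => Some (T, [::])
  | c :: rs' =>
    match rot c T with
    | None => None
    | Some T' =>
      match run_rots T' rs' with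
      | None => None
      | Some (T'', E) => Some (T'', c :: parent T c :: E)
      end
    end
  end.

Fixpoint lcp (s t : seq nat) : seq nat :=
  match s, t with
  | x :: s', y :: t' => if x == y then x :: lcp s' t' else [::]
  | _, _ => [::]
  end.

(* Node set of the minimal (connected) subtree of T containing the nodes E:
   the nodes that are ancestors-or-self of some e in E and
   descendants-or-self of the lowest common ancestor of E. *)
Definition hull (T : tree) (E : seq nat) : seq nat :=
  let paths := map (path T) E in
  let cp := foldl lcp (head [::] paths) (behead paths) in
  let lca := last 0 cp in
  undup [seq v <- flatten paths | lca \in path T v].

Definition step_cost (T : tree) (x : nat) (E : seq nat) : nat :=
  size (undup (path T x ++ hull T E)).

(* A (possibly offline) algorithm's behaviour on (X, T0) is a schedule:
   one rotation sequence per query.  Cost, or None if some rotation is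
   invalid or the lengths mismatch. *)
Fixpoint sched_cost (T : tree) (X : seq nat) (S : seq (seq nat)) : option nat :=
  match X, S with
  | [::], [::] => Some 0
  | x :: X', rs :: S' =>
    match run_rots T rs with
    | None => None
    | Some (T', E) => omap (fun c => step_cost T x E + c) (sched_cost T' X' S')
    end
  | _, _ => None
  end.

Definition is_opt_cost (T0 : tree) (X : seq nat) (k : nat) : Prop :=
  (exists S, sched_cost T0 X S = Some k) /\
  (forall S k', sched_cost T0 X S = Some k' -> k <= k').

Fixpoint hang (T : tree) (x : nat) : seq tree :=
  match T with
  | Leaf => [::]
  | Node l k r =>
    if x < k then rcons (hang l x) r
    else if k < x then l :: hang r x
    else [:: l; r]
  end.

Fixpoint plug (t : tree) (rs : seq tree) : tree * seq tree :=
  match t with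
  | Leaf => (head Leaf rs, behead rs)
  | Node l k r =>
    let (l', rs1) := plug l rs in
    let (r', rs2) := plug r rs1 in
    (Node l' k r', rs2)
  end.

Definition pbetter (p q : nat * nat) : bool :=
  (p.1 < q.1) || ((p.1 == q.1) && (p.2 < q.2)).

Definition argbest (f : nat -> nat * nat) (v0 : nat) (s : seq nat) : nat :=
  foldl (fun b v => if pbetter (f v) (f b) then v else b) v0 s.

Fixpoint build (fuel : nat) (f : nat -> nat * nat) (vs : seq nat) : tree :=
  match fuel with
  | 0 => Leaf
  | fu.+1 =>
    match vs with
    | [::] => Leaf
    | v0 :: _ =>
      let v := argbest f v0 vs in
      Node (build fu f [seq y <- vs | y < v]) v (build fu f [seq y <- vs | v < y])
    end
  end.

(* tau(v_i) relative to the future queries x_{t+1}, x_{t+2}, ...: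
   index of the first future query in (v_{i-1}, v_{i+1}); equals
   size future (playing the role of +infinity) if none. *)
Definition tau (vs : seq nat) (future : seq nat) (v : nat) : nat :=
  let i := index v vs in
  let lo := if i == 0 then None else Some (nth 0 vs i.-1) in
  let hi := if i.+1 < size vs then Some (nth 0 vs i.+1) else None in
  find (fun y => (if lo is Some a then a < y else true) &&
                 (if hi is Some b then y < b else true)) future.

Definition gf_step (T : tree) (x : nat) (future : seq nat) : tree :=
  let P := path T x in
  let vs := sort leq P in
  let f v := (tau vs future v, index v P) in
  (plug (build (size vs) f vs) (hang T x)).1.

(* cost(GF, X, T0): GF restructures only the search path, so U_t is
   contained in P_t and the cost at time t is |P_t|. *)
Fixpoint gf_cost (T : tree) (X : seq nat) : nat :=
  match X with
  | [::] => 0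
  | x :: X' => size (path T x) + gf_cost (gf_step T x X') X'
  end.

(* Main.v *)
(* The keys form a recursive block: two copies of a smaller block, left and
   right, around a pivot that is flanked by two buffers which are never queried.
   The queries cycle through pivot, left copy, right copy, and each copy
   receives the same sequence recursively.  A static tree with the pivots on top
   and the buffers at the bottom pays one node per level.  Greedy Future keeps
   pulling the buffers up: the path to the pivot contains both buffers, the path
   into the left copy contains the first one, the path into the right copy
   contains both, so on average GF pays two nodes per level.  Only the innermost
   blocks, a single key each, cost both algorithms the same; over a period of
   3^k queries this gives cost(GF) = 2 * cost(static) - 2^k, while the static
   cost is at least 3^k.  The optimum reaches the static tree by rotations during
   the first query, at a cost that does not depend on the number of queries.

   GF's path costs are bounded below through ancestor relations: [b \in path T y]
   says that [b] is an ancestor of [y].  GF preserves the descendants of a node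
   off the search path, and a node [b] on the path becomes an ancestor of [y] as
   soon as it has the best priority among the path nodes from [b] to [y]. *)

Require Import Defs.
From mathcomp Require Import all_boot zify.
From Stdlib Require Import Reals Classical Lra.
Import Defs.

Set Implicit Arguments.
Unset Strict Implicit.
Unset Printing Implicit Defensive.

(** * Paths and Greedy Future steps *)

Definition bst (T : tree) : bool := sorted ltn (inorder T).

Lemma sorted_ltn_mid (s1 s2 : seq nat) (k : nat) :
  sorted ltn (s1 ++ k :: s2) =
  [&& sorted ltn s1, sorted ltn s2, all (ltn^~ k) s1 & all (ltn k) s2].
Proof.
rewrite !(sorted_pairwise ltn_trans) pairwise_cat /= allrel_consr.
apply/idP/idP.
  by case/and3P=> /andP[-> _] -> /andP[-> ->].
case/and4P=> -> -> hl hr; rewrite hl hr !andbT /=.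
apply/allrelP=> x y xs ys.
exact: ltn_trans (allP hl _ xs) (allP hr _ ys).
Qed.

Lemma bst_node l k r :
  bst (Node l k r) =
  [&& bst l, bst r, all (ltn^~ k) (inorder l) & all (ltn k) (inorder r)].
Proof. exact: sorted_ltn_mid. Qed.

Lemma bst_nodeP l k r : bst (Node l k r) ->
  [/\ bst l, bst r, forall z : nat, z \in inorder l -> z < k
    & forall z : nat, z \in inorder r -> k < z].
Proof. by rewrite bst_node => /and4P[-> -> /allP hl /allP hr]; split. Qed.

Lemma inorder_node l k r (x : nat) : bst (Node l k r) ->
  (x \in inorder (Node l k r)) =
  if x < k then x \in inorder l else if k < x then x \in inorder r else true.
Proof.
case/bst_nodeP=> _ _ hl hr; rewrite mem_cat inE.
case: (ltngtP x k) => [xk|kx|->]; last by rewrite orbT.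
  by rewrite /=; case: (boolP (x \in inorder r)) => [/hr|_]; [lia|rewrite orbF].
by case: (boolP (x \in inorder l)) => [/hl|//]; lia.
Qed.

Lemma path_sub T (x : nat) : {subset path T x <= inorder T}.
Proof.
elim: T => //= l IHl k r IHr y; rewrite inE mem_cat inE => /orP[->|].
  by rewrite orbT.
by case: ifP => _; [move=> /IHl -> | case: ifP => // _ /IHr ->; rewrite !orbT].
Qed.

Lemma path_node_lt l k r x : x < k -> path (Node l k r) x = k :: path l x.
Proof. by move=> /= ->. Qed.

Lemma path_node_gt l k r x : k < x -> path (Node l k r) x = k :: path r x.
Proof. by move=> h /=; rewrite h ltnNge (ltnW h). Qed.

Lemma path_self T (x : nat) : bst T -> x \in inorder T -> x \in path T x.
Proof.
elim: T => //= l IHl k r IHr hb; rewrite inorder_node //.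
have [hl hr _ _] := bst_nodeP hb; rewrite inE.
case: (ltngtP x k) => //= _; [exact: IHl | exact: IHr].
Qed.

Lemma path_uniq T (x : nat) : bst T -> uniq (path T x).
Proof.
elim: T => //= l IHl k r IHr hb; have [hl hr al ar] := bst_nodeP hb.
case: ltngtP => //= _; rewrite ?IHl ?IHr // andbT.
  by apply/negP=> /path_sub /al; rewrite ltnn.
by apply/negP=> /path_sub /ar; rewrite ltnn.
Qed.

Definition between (a b y : nat) : bool := (a <= y <= b) || (b <= y <= a).

(** The descendants of [z] form an interval of keys, which contains [z] and [x] and hence everything
    between them. *)
Lemma path_between T (x y z : nat) : bst T ->
  z \in path T x -> between z x y -> z \in path T y.
Proof.
rewrite /between; elim: T => //= l IHl k r IHr hb.
have [hl hr al ar] := bst_nodeP hb.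
rewrite !inE => /orP[->//|]; case: ltngtP => // xk hz hy.
- have zk := al _ (path_sub hz).
  have -> : y < k by lia.
  by rewrite /= IHl ?orbT.
- have zk := ar _ (path_sub hz).
  have -> : k < y by lia.
  have -> : y < k = false by lia.
  by rewrite /= IHr ?orbT.
Qed.

Lemma path_prefix T (x z : nat) : bst T -> z \in path T x ->
  exists s, path T x = path T z ++ s.
Proof.
elim: T => //= l IHl k r IHr hb; have [hl hr al ar] := bst_nodeP hb.
rewrite inE => /orP[/eqP ->|hz].
  by rewrite ltnn; eexists; reflexivity.
case: (ltngtP x k) hz => // xk hz.
- have -> := al _ (path_sub hz).
  by have [s ->] := IHl hl hz; exists s.
- have kz := ar _ (path_sub hz); rewrite kz ltnNge (ltnW kz) /=.
  by have [s ->] := IHr hr hz; exists s.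
Qed.

Lemma path_trans T (a b c : nat) : bst T ->
  a \in path T b -> b \in path T c -> a \in path T c.
Proof. by move=> hb ab /(path_prefix hb)[s ->]; rewrite mem_cat ab. Qed.

Lemma path_antisym T (a b : nat) : bst T ->
  a \in path T b -> b \in path T a -> a = b.
Proof.
elim: T => //= l IHl k r IHr hb; have [hl hr al ar] := bst_nodeP hb.
rewrite !inE => /orP[/eqP ->|ha] /orP[/eqP eb|hb'] //.
- by move: hb'; rewrite ltnn.
- by move: ha; rewrite eb ltnn.
case: (ltngtP b k) ha => // bk ha.
- by have ak := al _ (path_sub ha); move: hb'; rewrite ak => hb'; apply: IHl.
- have ak := ar _ (path_sub ha); move: hb'.
  by rewrite ak ltnNge (ltnW ak) /= => hb'; apply: IHr.
Qed.

(** Otherwise [b], lying between [z] and [x], would be a descendant of [z] as well as a proper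
    ancestor. This is how a buffer keeps the keys behind it off a search path. *)
Lemma path_blocked T (x z b : nat) : bst T ->
  b \in path T z -> b != z -> between z x b -> z \notin path T x.
Proof.
move=> hT hbz hne hbt; apply/negP=> hz; move/negP: hne; apply; apply/eqP.
exact: path_antisym hT hbz (path_between hT hz hbt).
Qed.

(** The index in a search path is the depth, so this feeds the tie-breaking rule of GF. *)
Lemma index_ancestor T (x b z : nat) : bst T ->
  b \in path T z -> b != z -> z \in path T x ->
  index b (path T x) < index z (path T x).
Proof.
move=> hT hbz hne hz.
have hb := path_trans hT hbz hz.
have hbb : b \in path T b by apply: path_self => //; apply: path_sub hb.
have [s ->] := path_prefix hT hb; rewrite !index_cat hbb.
case: ifP => [hz'|_]; last by rewrite -index_mem in hbb; lia.
by rewrite (path_antisym hT hbz hz') eqxx in hne.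
Qed.

(** * Path keys and hanging subtrees *)

Fixpoint weave (vs : seq nat) (rs : seq (seq nat)) : seq nat :=
  if vs is v :: vs' then head [::] rs ++ v :: weave vs' (behead rs)
  else head [::] rs.

Lemma weave_mid s1 k s2 rs :
  weave (s1 ++ k :: s2) rs = weave s1 rs ++ k :: weave s2 (drop (size s1).+1 rs).
Proof.
elim: s1 rs => [|v s1 IH] [|r rs] //=; rewrite ?drop0 // IH -?catA //=.
Qed.

Lemma weave_rcons vs k rs r : size rs = (size vs).+1 ->
  weave (rcons vs k) (rcons rs r) = weave vs rs ++ k :: r.
Proof.
move=> hs; rewrite -cats1 weave_mid -cats1 -hs drop_size_cat //=; congr (_ ++ _).
elim: vs rs hs => [|v vs IH] [|r' rs] //= [hs].
by rewrite IH.
Qed.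

(** A tree has one more leaf than keys, and each leaf consumes one entry of [rs]. *)
Lemma plug_rest t rs : (plug t rs).2 = drop (size (inorder t)).+1 rs.
Proof.
elim: t rs => [|l IHl k r IHr] rs /=; first by rewrite drop1.
have := IHl rs; case: (plug l rs) => l' rs1 /= ->.
have := IHr (drop (size (inorder l)).+1 rs).
case: (plug r _) => r' rs2 /= ->.
by rewrite drop_drop size_cat /= addSn addnC addnS.
Qed.

Lemma plug_node l k r rs :
  (plug (Node l k r) rs).1 =
  Node (plug l rs).1 k (plug r (drop (size (inorder l)).+1 rs)).1.
Proof.
rewrite /=; have := plug_rest l rs; case: (plug l rs) => l' rs1 /= ->.
by case: (plug r _).
Qed.

(** The right-hand side sees only the key order of [t], not its shape; hence rearranging the path
    keys preserves the in-order sequence. *)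
Lemma inorder_plug t rs :
  inorder (plug t rs).1 = weave (inorder t) (map inorder rs).
Proof.
elim: t rs => [|l IHl k r IHr] rs; first by case: rs.
by rewrite plug_node /= IHl IHr weave_mid map_drop.
Qed.

Lemma path_plug_sub t rs y : {subset path t y <= path (plug t rs).1 y}.
Proof.
elim: t rs => [|l IHl k r IHr] rs // z; rewrite plug_node /= !inE.
case/orP=> [->//|]; case: ifP => _; first by move=> /IHl ->; rewrite orbT.
by case: ifP => // _ /IHr ->; rewrite orbT.
Qed.

(** A search for a key outside [t] leaves it at the leaf whose rank is the number of smaller keys of
    [t]. In [path_hang] the same rank selects the hanging subtree, so [y] sits in the same subtree
    before and after a GF step. *)
Lemma path_plug t rs (y : nat) : bst t -> y \notin inorder t ->
  path (plug t rs).1 y =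
  path t y ++ path (nth Leaf rs (count (ltn^~ y) (inorder t))) y.
Proof.
elim: t rs => [|l IHl k r IHr] rs hb; first by case: rs.
rewrite plug_node inorder_node //= count_cat /=.
have [hl hr al ar] := bst_nodeP hb.
case: (ltngtP y k) => //= yk hy.
- rewrite IHl // (@eq_in_count _ _ pred0 (inorder r)) ?count_pred0 ?addn0 //.
  by move=> z /ar /=; lia.
- rewrite IHr // nth_drop; congr (_ :: _ ++ path (nth _ _ _) _).
  have -> : count (ltn^~ y) (inorder l) = size (inorder l).
    by apply/eqP; rewrite -all_count; apply/allP=> z /al /=; lia.
  by rewrite add1n addnS.
Qed.

Lemma size_hang T (x : nat) : bst T -> x \in inorder T ->
  size (hang T x) = (size (path T x)).+1.
Proof.
elim: T => //= l IHl k r IHr hb; rewrite inorder_node //.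
have [hl hr _ _] := bst_nodeP hb.
by case: ltngtP => //= _ hx; rewrite ?size_rcons ?IHl ?IHr.
Qed.

Lemma sorted_sort_path T (x : nat) : bst T -> sorted ltn (sort leq (path T x)).
Proof.
move=> hb; rewrite ltn_sorted_uniq_leq sort_uniq path_uniq //=.
by apply: sort_sorted; apply: leq_total.
Qed.

Lemma sorted_ltn_eq s1 s2 :
  sorted ltn s1 -> sorted ltn s2 -> s1 =i s2 -> s1 = s2.
Proof. by apply: irr_sorted_eq; [apply: ltn_trans | apply: ltnn]. Qed.

Lemma inorder_hang T (x : nat) : bst T -> x \in inorder T ->
  weave (sort leq (path T x)) (map inorder (hang T x)) = inorder T.
Proof.
elim: T => //= l IHl k r IHr hb; rewrite inorder_node //.
have [hl hr al ar] := bst_nodeP hb.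
case: ltngtP => //= xk hx.
- have -> : sort leq (k :: path l x) = rcons (sort leq (path l x)) k.
    apply: sorted_ltn_eq; last by move=> z; rewrite mem_rcons mem_sort !inE mem_sort.
      by have := @sorted_sort_path (Node l k r) x hb; rewrite path_node_lt.
    rewrite -cats1 sorted_ltn_mid sorted_sort_path //= andbT.
    by apply/allP=> z; rewrite mem_sort => /path_sub /al.
  by rewrite map_rcons weave_rcons ?IHl // size_map size_hang // size_sort.
- have -> : sort leq (k :: path r x) = k :: sort leq (path r x).
    apply: sorted_ltn_eq; last by move=> z; rewrite mem_sort !inE mem_sort.
      by have := @sorted_sort_path (Node l k r) x hb; rewrite path_node_gt.
    rewrite -[_ :: _]cat0s sorted_ltn_mid sorted_sort_path //=.
    by apply/allP=> z; rewrite mem_sort => /path_sub /ar.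
  by rewrite /= IHr.
Qed.

Lemma path_hang T (x y : nat) : bst T -> x \in inorder T -> y \notin path T x ->
  exists2 s, {subset s <= path T x}
    & path T y = s ++ path (nth Leaf (hang T x) (count (ltn^~ y) (path T x))) y.
Proof.
elim: T => //= l IHl k r IHr hb; rewrite inorder_node //.
have [hl hr al ar] := bst_nodeP hb.
case: ltngtP => //= xk hx.
- rewrite inE negb_or => /andP[yk hy]; case: (ltngtP y k) yk => //= yk _.
    have [s hs ->] := IHl hl hx hy; exists (k :: s).
      by move=> z; rewrite !inE => /orP[->|/hs ->] //; rewrite orbT.
    rewrite nth_rcons add0n size_hang //.
    by rewrite ltnS count_size.
  exists [:: k]; first by move=> z; rewrite !inE => ->.
  have -> : count (ltn^~ y) (path l x) = size (path l x).
    by apply/eqP; rewrite -all_count; apply/allP=> z /path_sub /al /=; lia.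
  by rewrite nth_rcons size_hang // add1n ltnn eqxx.
- rewrite inE negb_or => /andP[yk hy]; case: (ltngtP y k) yk => //= yk _.
    exists [:: k]; first by move=> z; rewrite !inE => ->.
    rewrite (@eq_in_count _ _ pred0) ?count_pred0 //.
    by move=> z /path_sub /ar /=; lia.
  have [s hs ->] := IHr hr hx hy; exists (k :: s) => //.
  by move=> z; rewrite !inE => /orP[->|/hs ->] //; rewrite orbT.
- rewrite inE => yk; exists [:: k]; first by move=> z; rewrite !inE => ->.
  by case: (ltngtP y k) yk => //=.
Qed.

(** * The treap built from the path keys *)

Lemma filter_lt_gt vs (v : nat) : sorted ltn vs -> v \in vs ->
  [seq y <- vs | y < v] ++ v :: [seq y <- vs | v < y] = vs.
Proof.
move=> hs hv; apply: sorted_ltn_eq => //.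
  rewrite sorted_ltn_mid !sorted_filter ?hs //=; try exact: ltn_trans.
  by apply/andP; split; apply/allP=> z; rewrite mem_filter => /andP[].
move=> z; rewrite mem_cat inE !mem_filter.
by case: ltngtP => [||->]; rewrite ?orbF ?hv.
Qed.

Lemma mem_argbest f (v0 : nat) s : argbest f v0 s \in v0 :: s.
Proof.
elim: s v0 => [|v s IH] v0 /=; first by rewrite inE.
have := IH (if pbetter (f v) (f v0) then v else v0).
by rewrite !inE; case: ifP => _ /orP[->|->]; rewrite ?orbT.
Qed.

Lemma argbest_best f (v0 : nat) s w : w \in v0 :: s ->
  ~~ pbetter (f w) (f (argbest f v0 s)).
Proof.
have irr p : ~~ pbetter p p by rewrite /pbetter; lia.
have ntr p q r : ~~ pbetter q p -> ~~ pbetter r q -> ~~ pbetter r p.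
  by rewrite /pbetter; lia.
elim: s v0 w => [|v s IH] v0 w /=; first by rewrite inE => /eqP ->.
set b := if _ then _ else _.
have hb : ~~ pbetter (f v) (f b) /\ ~~ pbetter (f v0) (f b).
  rewrite /b; case: ifP => h; split => //; last by rewrite h.
  by move: h; rewrite /pbetter; lia.
have hbb : ~~ pbetter (f b) (f (argbest f b s)) by apply: IH; rewrite mem_head.
rewrite !inE => /or3P[/eqP ->|/eqP ->|hw].
- exact: ntr hbb hb.2.
- exact: ntr hbb hb.1.
- by apply: IH; rewrite inE hw orbT.
Qed.

Lemma inorder_build fuel f vs : sorted ltn vs -> size vs <= fuel ->
  inorder (build fuel f vs) = vs.
Proof.
elim: fuel vs => [|fu IH] [|v0 vs] // hs hz.
set s := v0 :: vs in hs hz *.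
have -> : build fu.+1 f s =
  let v := argbest f v0 s in
  Node (build fu f [seq y <- s | y < v]) v (build fu f [seq y <- s | v < y]) by [].
have hv : argbest f v0 s \in s.
  by have := mem_argbest f v0 s; rewrite !inE orbA orbb.
move: (argbest f v0 s) hv => v hv; clearbody s => /=.
have hlen := filter_lt_gt hs hv.
have /(congr1 size) := hlen; rewrite size_cat [X in _ + X]/= => hsz.
rewrite !IH ?sorted_filter //; try exact: ltn_trans; lia.
Qed.

(** The root of the treap separates [b] from [y] only if it lies between them, and then [b] would
    have better priority than the best key. So [b] is the root, or it lies on the same side of the
    root as [y] and the induction continues there. *)
Lemma path_build fuel f vs (b y : nat) : sorted ltn vs -> size vs <= fuel ->
  b \in vs ->
  (forall z, z \in vs -> z != b -> between b y z -> pbetter (f b) (f z)) ->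
  b \in path (build fuel f vs) y.
Proof.
elim: fuel vs => [|fu IH] [|v0 vs] // hs hz.
set s := v0 :: vs in hs hz * => hb hbest.
have -> : build fu.+1 f s =
  let v := argbest f v0 s in
  Node (build fu f [seq y <- s | y < v]) v (build fu f [seq y <- s | v < y]) by [].
have hv : argbest f v0 s \in s.
  by have := mem_argbest f v0 s; rewrite !inE orbA orbb.
have hnb : ~~ pbetter (f b) (f (argbest f v0 s)).
  by apply: argbest_best; rewrite inE hb orbT.
move: (argbest f v0 s) hv hnb => v hv hnb; clearbody s => /=.
have /(congr1 size) := filter_lt_gt hs hv; rewrite size_cat [X in _ + X]/= => hsz.
rewrite inE; case: (eqVneq b v) => //= hbv.
have hnbt : ~~ between b y v.
  by apply/negP=> h; rewrite hbest // eq_sym in hnb.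
move: hnbt; rewrite /between => hnbt.
case: (ltngtP y v) => hyv.
- apply: IH; [by apply: sorted_filter => //; apply: ltn_trans | lia | |].
    by rewrite mem_filter hb andbT; lia.
  by move=> z; rewrite mem_filter => /andP[_]; apply: hbest.
- apply: IH; [by apply: sorted_filter => //; apply: ltn_trans | lia | |].
    by rewrite mem_filter hb andbT; lia.
  by move=> z; rewrite mem_filter => /andP[_]; apply: hbest.
- lia.
Qed.

(* Says that [y] lies strictly between the neighbours of [v] in [P]; a missing
   neighbour imposes no condition. *)
Definition window (P : seq nat) (v y : nat) : bool :=
  all (fun u => ((u < v) ==> (u < y)) && ((v < u) ==> (y < u))) P.

(** In a sorted list the adjacent keys impose the strongest bounds, so bounding by all keys is the
    same condition. The window form does not mention the order of the list and applies to the
    unsorted search path. *)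
Lemma tau_window vs F (v : nat) : sorted ltn vs -> v \in vs ->
  tau vs F v = find (window vs v) F.
Proof.
move=> hs hv; apply: eq_find => y.
have [s1 [s2 hvs]] : exists s1 s2, vs = s1 ++ v :: s2.
  by have /splitPr[s1 s2] := hv; exists s1, s2.
move: hs; rewrite hvs sorted_ltn_mid => /and4P[hs1 hs2 /allP h1 /allP h2].
have {}h1 (z : nat) : z \in s1 -> z < v by exact: h1.
have {}h2 (z : nat) : z \in s2 -> v < z by exact: h2.
have hn : v \notin s1 by apply/negP=> /h1; rewrite ltnn.
rewrite index_cat (negPf hn) /= eqxx addn0 size_cat /= addnS ltnS.
rewrite /window all_cat /= ltnn /=; congr (_ && _).
- case: (lastP s1) hs1 h1 {hn hvs} => [|s u] // hs1 h1; rewrite size_rcons /=.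
  rewrite nth_cat size_rcons ltnSn nth_rcons ltnn eqxx.
  have uv : u < v by apply: h1; rewrite mem_rcons mem_head.
  rewrite all_rcons uv /=; have -> /= : v < u = false by lia.
  rewrite andbT; apply/idP/idP => [hu|/andP[]//]; rewrite hu /=.
  apply/allP=> z hz; have zv : z < v by apply: h1; rewrite mem_rcons inE hz orbT.
  move: hs1; rewrite -cats1 sorted_ltn_mid => /and4P[_ _ /allP/(_ z hz)] /=; lia.
- case: s2 hs2 h2 {hvs} => [|u s] hs2 h2; first by rewrite addn0 ltnn.
  rewrite /= addnS ltnS leq_addr nth_cat.
  have -> : (size s1).+1 < size s1 = false by lia.
  have -> : (size s1).+1 - size s1 = 1 by lia.
  have vu : v < u by apply: h2; rewrite mem_head.
  rewrite /= vu /=; have -> /= : u < v = false by lia.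
  apply/idP/idP => [hu|/andP[]//]; rewrite hu /=.
  apply/allP=> z hz; have zv : v < z by apply: h2; rewrite inE hz orbT.
  move: hs2; rewrite -[u :: s]cat0s sorted_ltn_mid => /and4P[_ _ _ /allP/(_ z hz)].
  rewrite /=; lia.
Qed.

Lemma eq_window P Q v : P =i Q -> window P v =1 window Q v.
Proof. by move=> h y; apply: eq_all_r. Qed.

(* By [tau_window] this is the comparison of [(tau, depth)] made by GF. *)
Definition beats T x F (b z : nat) : bool :=
  pbetter (find (window (path T x) b) F, index b (path T x))
          (find (window (path T x) z) F, index z (path T x)).

Lemma inorder_gf_step T x F : bst T -> x \in inorder T ->
  inorder (gf_step T x F) = inorder T.
Proof.
move=> hT hx; rewrite /gf_step inorder_plug inorder_build ?inorder_hang //.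
exact: sorted_sort_path.
Qed.

(** The path to [y] follows the search path and then enters one hanging subtree, which GF reattaches
    unchanged; a node off the search path can occur only in that second portion. *)
Lemma gf_keep T x F (b y : nat) : bst T -> x \in inorder T ->
  b \notin path T x -> b \in path T y -> b \in path (gf_step T x F) y.
Proof.
move=> hT hx hb hby.
have hy : y \notin path T x by apply: contra hb; apply: path_trans.
rewrite /gf_step; set f := (fun v => _).
have hs := sorted_sort_path x hT.
have hB := inorder_build f hs (leqnn _).
rewrite path_plug /bst ?hB ?mem_sort // mem_cat.
have [s hsub hp] := path_hang hT hx hy.
move: hby; rewrite hp mem_cat => /orP[/hsub|]; first by rewrite (negPf hb).
have -> : count (ltn^~ y) (sort leq (path T x)) = count (ltn^~ y) (path T x).
  by apply/permP; rewrite perm_sort.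
by move=> ->; rewrite orbT.
Qed.

Lemma gf_beat T x F (b y : nat) : bst T -> x \in inorder T ->
  b \in path T x ->
  (forall z, z \in path T x -> z != b -> between b y z -> beats T x F b z) ->
  b \in path (gf_step T x F) y.
Proof.
move=> hT hx hb hbest; rewrite /gf_step; set f := (fun v => _).
have hs := sorted_sort_path x hT.
apply: path_plug_sub; apply: path_build; rewrite ?mem_sort //.
move=> z; rewrite mem_sort => hz hzb hbt; rewrite /f !tau_window ?mem_sort //.
have hw v : window (sort leq (path T x)) v =1 window (path T x) v.
  by apply: eq_window => u; rewrite mem_sort.
by rewrite !(eq_find (hw _)); apply: hbest.
Qed.

(** No hit of [q] precedes the first element of [F] in [J], where [p] already holds. If [F] has no
    element in [J], then [q] is never hit and its index is the default [size F]. *)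
Lemma find_filter_leq (J p q : pred nat) F : {in F, forall y, q y -> J y} ->
  (if filter J F is y :: _ then p y else true) -> find p F <= find q F.
Proof.
elim: F => //= y F IH hq; case: (boolP (J y)) => hJ /= hp; first by rewrite hp.
have /negPf -> : ~~ q y by apply: contra hJ; apply: hq; rewrite mem_head.
case: ifP => // _; rewrite ltnS; apply: IH => // z hz; apply: hq.
by rewrite inE hz orbT.
Qed.

Lemma find_filter_ltn (J p q : pred nat) F y s : {in F, forall y, q y -> J y} ->
  filter J F = y :: s -> p y -> ~~ q y -> find p F < find q F.
Proof.
elim: F => //= z F IH hq; case: (boolP (J z)) => hJ /= hp py qy.
  by case: hp => -> _; rewrite py (negPf qy).
have /negPf -> : ~~ q z by apply: contra hJ; apply: hq; rewrite mem_head.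
case: ifP => // _; rewrite ltnS; apply: IH => // w hw; apply: hq.
by rewrite inE hw orbT.
Qed.

(** A weak inequality between the values of tau suffices, because a tie goes to the node of smaller
    depth. [J] is any region containing the future hits of the window of [z]; only the first query
    in [J] has to be examined. *)
Lemma beats_ancestor T x F (b z : nat) (J : pred nat) : bst T ->
  b \in path T z -> z \in path T x -> b != z ->
  {in F, forall y, window (path T x) z y -> J y} ->
  (if filter J F is y :: _ then window (path T x) b y else true) ->
  beats T x F b z.
Proof.
move=> hT hbz hz hne hJ hh; rewrite /beats /pbetter /=.
have := index_ancestor hT hbz hne hz; have := find_filter_leq hJ hh; lia.
Qed.

Lemma windowP P (v y : nat) :
  reflect (forall u, u \in P -> (u < v -> u < y) /\ (v < u -> y < u))
          (window P v y).
Proof.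
apply: (iffP allP) => h u hu.
  by have /andP[/implyP ? /implyP ?] := h u hu.
by have [? ?] := h u hu; apply/andP; split; apply/implyP.
Qed.

(** * The recursive block *)

(* In key order, the block of level [k.+1] at offset [a] consists of the left
   copy at offset [a], the first buffer [a + width k + 1], the pivot
   [a + width k + 2], the second buffer [a + width k + 3], and the right copy at
   offset [a + width k + 3]. *)
Fixpoint width (k : nat) : nat := if k is k'.+1 then 2 * width k' + 3 else 1.

Lemma widthS k : width k.+1 = 2 * width k + 3.
Proof. by []. Qed.

Definition block (k a y : nat) : bool := a < y <= a + width k.

Fixpoint query (k a t : nat) : nat :=
  if k is k'.+1 then
    match t %% 3 with
    | 0 => a + width k' + 2
    | 1 => query k' a (t %/ 3)
    | _ => query k' (a + width k' + 3) (t %/ 3)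
    end
  else a.+1.

Lemma query_pivot k a t : t %% 3 = 0 -> query k.+1 a t = a + width k + 2.
Proof. by move=> /= ->. Qed.

Lemma query_left k a t : t %% 3 = 1 -> query k.+1 a t = query k a (t %/ 3).
Proof. by move=> /= ->. Qed.

Lemma query_right k a t : t %% 3 = 2 ->
  query k.+1 a t = query k (a + width k + 3) (t %/ 3).
Proof. by move=> /= ->. Qed.

Lemma mod3P t : [\/ t %% 3 = 0, t %% 3 = 1 | t %% 3 = 2].
Proof.
have : t %% 3 < 3 by rewrite ltn_mod.
by case: (t %% 3) => [|[|[|]]] // _; [apply: Or31|apply: Or32|apply: Or33].
Qed.

Lemma query_block k a t : block k a (query k a t).
Proof.
rewrite /block; elim: k a t => [|k IH] a t; first by rewrite /=; lia.
case: (mod3P t) => ht.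
- rewrite query_pivot // /=; lia.
- rewrite query_left //=; have := IH a (t %/ 3); lia.
- rewrite query_right //=; have := IH (a + width k + 3) (t %/ 3); lia.
Qed.

(** Only the queries that fall in the block are constrained: queries to other blocks may be
    interleaved, and the sequence may stop at any point. *)
Definition follows (k a t : nat) (F : seq nat) : Prop :=
  exists n, filter (block k a) F = map (query k a) (iota t n).

Lemma filter_sub (p q : pred nat) F : subpred p q ->
  filter p F = filter p (filter q F).
Proof.
move=> hpq; rewrite -filter_predI; apply: eq_filter => y /=.
by case: (boolP (p y)) => // /hpq ->.
Qed.

Lemma filter_map_iotaS (p : pred nat) f t n :
  filter p (map f (iota t n.+1)) =
  if p (f t) then f t :: filter p (map f (iota t.+1 n))
  else filter p (map f (iota t.+1 n)).
Proof. by []. Qed.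

(** Exactly one query in each round of three reaches the left copy, so its clock advances only at
    [t %% 3 = 1]. *)
Lemma follows_left k a t F :
  follows k.+1 a t F -> follows k a ((t + 1) %/ 3) F.
Proof.
case=> n hF; rewrite /follows (@filter_sub _ (block k.+1 a)); last first.
  by rewrite /block /= => y; lia.
rewrite {F}hF; elim: n t => [|n IH] t; first by exists 0.
have [n' hn'] := IH t.+1.
case: (mod3P t) => ht.
- exists n'; rewrite filter_map_iotaS query_pivot //.
  have -> : block k a (a + width k + 2) = false by rewrite /block; lia.
  by rewrite hn'; have -> : (t.+1 + 1) %/ 3 = (t + 1) %/ 3 by lia.
- exists n'.+1; rewrite filter_map_iotaS query_left //.
  rewrite query_block hn' /=.
  have -> : (t.+1 + 1) %/ 3 = ((t + 1) %/ 3).+1 by lia.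
  by have -> : t %/ 3 = (t + 1) %/ 3 by lia.
- exists n'; rewrite filter_map_iotaS query_right //.
  have -> : block k a (query k (a + width k + 3) (t %/ 3)) = false.
    have := query_block k (a + width k + 3) (t %/ 3); rewrite /block; lia.
  by rewrite hn'; have -> : (t.+1 + 1) %/ 3 = (t + 1) %/ 3 by lia.
Qed.

Lemma follows_right k a t F :
  follows k.+1 a t F -> follows k (a + width k + 3) (t %/ 3) F.
Proof.
case=> n hF; rewrite /follows (@filter_sub _ (block k.+1 a)); last first.
  by rewrite /block /= => y; lia.
rewrite {F}hF; elim: n t => [|n IH] t; first by exists 0.
have [n' hn'] := IH t.+1.
case: (mod3P t) => ht.
- exists n'; rewrite filter_map_iotaS query_pivot //.
  have -> : block k (a + width k + 3) (a + width k + 2) = false.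
    by rewrite /block; lia.
  by rewrite hn'; have -> : t.+1 %/ 3 = t %/ 3 by lia.
- exists n'; rewrite filter_map_iotaS query_left //.
  have -> : block k (a + width k + 3) (query k a (t %/ 3)) = false.
    have := query_block k a (t %/ 3); rewrite /block; lia.
  by rewrite hn'; have -> : t.+1 %/ 3 = t %/ 3 by lia.
- exists n'.+1; rewrite filter_map_iotaS query_right //.
  rewrite query_block hn' /=.
  by have -> : t.+1 %/ 3 = (t %/ 3).+1 by lia.
Qed.

Lemma follows_cons k a t x F : follows k a t (x :: F) ->
  if block k a x then x = query k a t /\ follows k a t.+1 F
  else follows k a t F.
Proof.
rewrite /follows /=; case: ifP => // _ [[|n] //= [-> hF]].
by split=> //; exists n.
Qed.

(* The buffers separate both copies and the pivot from the rest of the tree;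
   just before the pivot is queried the two buffers may be in either order. *)
Definition shielded (k a t : nat) (T : tree) : Prop :=
  [/\ forall y, a < y <= a + width k + 2 -> a + width k + 1 \in path T y,
      forall y, a + width k + 2 <= y <= a + width k.+1 ->
        a + width k + 3 \in path T y
    & t %% 3 != 0 -> a + width k + 1 \in path T (a + width k + 3)].

(* If [t] queries to a block precede, its left copy has received
   [(t + 1) %/ 3] of them and its right copy [t %/ 3]. *)
Fixpoint gf_invariant k a t F T : Prop :=
  if k is k'.+1 then
    [/\ has (block k a) F -> shielded k' a t T,
        gf_invariant k' a ((t + 1) %/ 3) F T
      & gf_invariant k' (a + width k' + 3) (t %/ 3) F T]
  else True.

(** The keys adjacent to the block are [a] and [a + width k + 1]; a block at an end of the key range
    has no neighbour there. With the neighbours on the path, windows of block keys stay inside the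
    block. *)
Definition enclosed (k a n : nat) (P : seq nat) : Prop :=
  (a = 0 \/ a \in P) /\ (a + width k = n \/ (a + width k).+1 \in P).

Lemma window_enclosed k a n P z y : enclosed k a n P -> block k a z ->
  window P z y -> 0 < y <= n -> block k a y.
Proof.
rewrite /block => -[hA hB] hz /windowP hw hy; apply/andP; split.
  by case: hA => [->|/hw[ha _]]; lia.
by case: hB => [->|/hw[_ hb]]; lia.
Qed.

Lemma follows_head (J p : pred nat) k a t F : subpred J (block k a) ->
  follows k a t F -> J (query k a t) -> p (query k a t) ->
  if filter J F is y :: _ then p y else true.
Proof.
move=> hJ [n hF] hq hp; rewrite (filter_sub _ hJ) hF.
by case: n {hF} => [//|n]; rewrite filter_map_iotaS hq.
Qed.

(** Serves to compare the second buffer with the pivot: the skipped query goes to the left copy,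
    outside the windows of both. *)
Lemma follows_head2 (J p : pred nat) k a t F : subpred J (block k a) ->
  follows k a t F -> ~~ J (query k a t) ->
  J (query k a t.+1) -> p (query k a t.+1) ->
  if filter J F is y :: _ then p y else true.
Proof.
move=> hJ [n hF] /negPf hq0 hq hp; rewrite (filter_sub _ hJ) hF.
case: n {hF} => [//|n]; rewrite filter_map_iotaS hq0.
by case: n => [//|n]; rewrite filter_map_iotaS hq.
Qed.

Lemma bst_is_bst_on n T : is_bst_on n T -> bst T.
Proof. by rewrite /is_bst_on /bst => ->; apply: iota_ltn_sorted. Qed.

Lemma mem_bst_on n T y : is_bst_on n T -> (y \in inorder T) = (0 < y <= n).
Proof. by rewrite /is_bst_on => ->; rewrite mem_iota; lia. Qed.

(** Each copy hangs below the buffer between it and the pivot, so [path_blocked] keeps both copies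
    off the path. *)
Lemma path_pivot k a n t T : is_bst_on n T -> a + width k.+1 <= n ->
  shielded k a t T ->
  let P := path T (a + width k + 2) in
  [/\ a + width k + 1 \in P, a + width k + 2 \in P, a + width k + 3 \in P,
      forall y, block k a y -> y \notin P
    & forall y, block k (a + width k + 3) y -> y \notin P].
Proof.
rewrite /block /= => hT hn [h1 h2 _]; rewrite /= in h2; have hb := bst_is_bst_on hT.
split.
- by apply: h1; lia.
- by apply: path_self; rewrite ?(mem_bst_on _ hT); lia.
- by apply: h2; lia.
- move=> y hy; apply: (@path_blocked _ _ _ (a + width k + 1)) => //.
  + by apply: h1; lia.
  + by lia.
  + by rewrite /between; lia.
- move=> y hy; apply: (@path_blocked _ _ _ (a + width k + 3)) => //.
  + by apply: h2; lia.
  + by lia.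
  + by rewrite /between; lia.
Qed.

(** Everything to the right of the first buffer hangs below it: the pivot directly, the second
    buffer and the right copy through the third clause of [shielded]. *)
Lemma path_left k a n t T x : is_bst_on n T -> a + width k.+1 <= n ->
  shielded k a t T -> t %% 3 != 0 -> block k a x ->
  let P := path T x in
  a + width k + 1 \in P /\
  forall y, a + width k + 1 < y <= a + width k.+1 -> y \notin P.
Proof.
rewrite /block /= => hT hn [h1 h2 h3] ht hx; rewrite /= in h2; have hb := bst_is_bst_on hT.
split; first by apply: h1; lia.
move=> y hy; apply: (@path_blocked _ _ _ (a + width k + 1)) => //.
- case: (ltnP y (a + width k + 3)) => hy3; first by apply: h1; lia.
  by apply: (path_trans hb (h3 ht)); apply: h2; lia.
- by lia.
- by rewrite /between; lia.
Qed.

Lemma path_right k a n t T x : is_bst_on n T -> a + width k.+1 <= n ->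
  shielded k a t T -> t %% 3 != 0 -> block k (a + width k + 3) x ->
  let P := path T x in
  [/\ a + width k + 1 \in P, a + width k + 3 \in P, a + width k + 2 \notin P
    & forall y, block k a y -> y \notin P].
Proof.
rewrite /block /= => hT hn [h1 h2 h3] ht hx; rewrite /= in h2; have hb := bst_is_bst_on hT.
have hb2 : a + width k + 3 \in path T x by apply: h2; lia.
split=> //; first by apply: (path_trans hb (h3 ht)).
- apply: (@path_blocked _ _ _ (a + width k + 3)) => //.
  + by apply: h2; lia.
  + by lia.
  + by rewrite /between; lia.
- move=> y hy; apply: (@path_blocked _ _ _ (a + width k + 1)) => //.
  + by apply: h1; lia.
  + by lia.
  + by rewrite /between; lia.
Qed.

(** * Preservation of the shields by a GF step *)

Lemma window_block k a n (P F : seq nat) (z : nat) : {in F, forall y, 0 < y <= n} ->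
  enclosed k a n P -> block k a z ->
  {in F, forall y, window P z y -> block k a y}.
Proof. by move=> hF he hz y /hF hy hw; apply: window_enclosed he hz hw hy. Qed.

(** The next two queries to the block go to the left and then to the right copy. The first lies in
    the window of the first buffer only, the second in that of the second buffer, so GF ranks the
    first buffer before the second and the second before the pivot. *)
Lemma shielded_pivot k a n t T (F : seq nat) :
  let x := a + width k + 2 in
  is_bst_on n T -> a + width k.+1 <= n -> {in F, forall y, 0 < y <= n} ->
  enclosed k.+1 a n (path T x) -> shielded k a t T -> t %% 3 = 0 ->
  follows k.+1 a t.+1 F -> has (block k.+1 a) F ->
  shielded k a t.+1 (gf_step T x F).
Proof.
move=> x hT hn hF henc hS ht hfol hhas; have hb := bst_is_bst_on hT.
have [p1 px p2 pL pR] := path_pivot hT hn hS; rewrite -/x in p1 px p2 pL pR.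
have hx : x \in inorder T by apply: path_sub px.
have {}pL u : u \in path T x -> ~~ block k a u by apply: contraL (pL u).
have {}pR u : u \in path T x -> ~~ block k (a + width k + 3) u.
  by apply: contraL (pR u).
have [h1 h2 _] := hS.
have hqL : block k a (query k.+1 a t.+1).
  by rewrite query_left; [apply: query_block | lia].
have hqR : block k (a + width k + 3) (query k.+1 a t.+2).
  by rewrite query_right; [apply: query_block | lia].
have hJ := window_block hF henc.
rewrite /block in pL pR.
have w1 : window (path T x) (a + width k + 1) (query k.+1 a t.+1).
  move: hqL; rewrite /block => hq; apply/windowP => u /pL hu.
  by clear -hq hu; lia.
have w2 : window (path T x) (a + width k + 3) (query k.+1 a t.+2).
  move: hqR; rewrite /block => hq; apply/windowP => u /pR hu.
  by clear -hq hu; lia.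
have b1x : beats T x F (a + width k + 1) x.
  apply: (@beats_ancestor _ _ _ _ _ (block k.+1 a)) => //.
  - by rewrite /x; clear; lia.
  - by apply: hJ; rewrite /block widthS /x; clear; lia.
  - by apply: (follows_head _ hfol) => //; apply: query_block.
have b12 : beats T x F (a + width k + 1) (a + width k + 3).
  rewrite /beats /pbetter /=; apply/orP; left.
  (* Without a further query to the block both values of tau could be infinite, and depth might
     favour the second buffer; [hhas] rules this out. *)
  have [[|m] hm] := hfol; first by rewrite has_filter hm in hhas.
  rewrite -[map _ _]/(query k.+1 a t.+1 :: map (query k.+1 a) (iota t.+2 m)) in hm.
  apply: (find_filter_ltn _ hm) => //.
  - by apply: hJ; rewrite /block widthS; clear; lia.
  - move: hqL; rewrite /block => hq; apply/negP=> /windowP/(_ x px).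
    by rewrite /x; clear -hq; lia.
have b2x : beats T x F (a + width k + 3) x.
  pose J y := a + width k + 1 < y <= a + width k.+1.
  apply: (@beats_ancestor _ _ _ _ _ J) => //.
  - by rewrite /x; clear; lia.
  - move=> y _ /windowP hy; have := hy _ p1; have := hy _ p2.
    by rewrite /J widthS /x; clear; lia.
  - apply: (follows_head2 _ hfol) => //; rewrite /J widthS.
    + by move=> y; rewrite /block widthS; clear; lia.
    + by move: hqL; rewrite /block; clear; lia.
    + by move: hqR; rewrite /block; clear; lia.
have inP u : u \in path T x -> a < u <= a + width k.+1 ->
    [\/ u = a + width k + 1, u = x | u = a + width k + 3].
  move=> hu hau; case: (eqVneq u (a + width k + 1)) => [|u1]; first exact: Or31.
  case: (eqVneq u x) => [|ux]; first exact: Or32.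
  apply: Or33; have := pL u hu; have := pR u hu.
  by move: ux hau; rewrite /x widthS; clear -u1; lia.
rewrite /between in inP *.
split=> [y hy|y hy|_]; apply: gf_beat => // z hz hzb; rewrite /between => hbt.
- have : a < z <= x by rewrite /x; clear -hy hbt; lia.
  move=> hz'; case: (inP z hz) => [||->|hz3] //.
  + by rewrite widthS; move: hz'; rewrite /x; clear; lia.
  + by move=> e; rewrite e eqxx in hzb.
  + by move: hz'; rewrite hz3 /x; clear; lia.
- have : x <= z <= a + width k.+1.
    by move: hy hbt; rewrite widthS /x; clear; lia.
  move=> hz'; case: (inP z hz) => [|hz1|->|hz3] //.
  + by move: hz'; rewrite widthS /x; clear; lia.
  + by move: hz'; rewrite hz1 /x; clear; lia.
  + by rewrite hz3 eqxx in hzb.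
- case: (inP z hz) => [|hz1|->|->] //.
  + by move: hbt; rewrite widthS; clear; lia.
  + by rewrite hz1 eqxx in hzb.
Qed.

(** The path has no key of the block to the right of the first buffer, whose window therefore
    contains the coming query to the right copy. So it beats all path nodes of the left copy and
    stays above them; the right part is not touched. *)
Lemma shielded_left k a n t T (x : nat) (F : seq nat) :
  is_bst_on n T -> a + width k.+1 <= n -> {in F, forall y, 0 < y <= n} ->
  enclosed k.+1 a n (path T x) -> shielded k a t T -> t %% 3 = 1 ->
  block k a x -> follows k.+1 a t.+1 F -> shielded k a t.+1 (gf_step T x F).
Proof.
move=> hT hn hF henc hS ht hxL hfol; have hb := bst_is_bst_on hT.
have ht0 : t %% 3 != 0 by rewrite ht.
have [p1 pR] := path_left hT hn hS ht0 hxL.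
have hx : x \in inorder T.
  rewrite (mem_bst_on _ hT); move: hxL hn; rewrite /block widthS; clear; lia.
have {}pR u : u \in path T x -> ~~ (a + width k + 1 < u <= a + width k.+1).
  by apply: contraL (pR u).
have [h1 h2 h3] := hS; rewrite /block in hxL.
have hqR : block k (a + width k + 3) (query k.+1 a t.+1).
  by rewrite query_right; [apply: query_block | lia].
have w1 : window (path T x) (a + width k + 1) (query k.+1 a t.+1).
  move: hqR; rewrite /block => hq; apply/windowP => u /pR hu.
  by rewrite widthS in hu; clear -hq hu; lia.
have b1z z : z \in path T x -> block k a z -> beats T x F (a + width k + 1) z.
  rewrite /block => hz hzL; apply: (@beats_ancestor _ _ _ _ _ (block k.+1 a)) => //.
  - by apply: h1; clear -hzL; lia.
  - by clear -hzL; lia.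
  - by apply: (window_block hF henc); rewrite /block widthS; clear -hzL; lia.
  - by apply: (follows_head _ hfol) => //; apply: query_block.
split=> [y hy|y hy|_].
- apply: gf_beat => // z hz hzb; rewrite /between => hbt.
  apply: b1z => //; have := pR z hz; rewrite /block widthS.
  by clear -hy hbt hzb; lia.
- apply: gf_keep => //; last by apply: h2.
  by apply/negP=> /pR; rewrite widthS; clear; lia.
- apply: gf_beat => // z hz hzb; rewrite /between => hbt.
  by have := pR z hz; rewrite widthS; clear -hzb hbt; lia.
Qed.

(** The next query to the block is the pivot, which is off the path and lies in the window of the
    second buffer; so this buffer stays above the right copy. The third clause of [shielded] is void
    at [t.+1]. *)
Lemma shielded_right k a n t T (x : nat) (F : seq nat) :
  is_bst_on n T -> a + width k.+1 <= n -> {in F, forall y, 0 < y <= n} ->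
  enclosed k.+1 a n (path T x) -> shielded k a t T -> t %% 3 = 2 ->
  block k (a + width k + 3) x -> follows k.+1 a t.+1 F ->
  shielded k a t.+1 (gf_step T x F).
Proof.
move=> hT hn hF henc hS ht hxR hfol; have hb := bst_is_bst_on hT.
have ht0 : t %% 3 != 0 by rewrite ht.
have [p1 p2 pv pL] := path_right hT hn hS ht0 hxR.
have hx : x \in inorder T.
  rewrite (mem_bst_on _ hT); move: hxR hn; rewrite /block widthS; clear; lia.
have {}pL u : u \in path T x -> ~~ block k a u by apply: contraL (pL u).
have {}pv u : u \in path T x -> u != a + width k + 2.
  by move=> hu; apply: contraNneq pv => <-.
have [h1 h2 h3] := hS.
have ht1 : t.+1 %% 3 = 0 by lia.
have w2 : window (path T x) (a + width k + 3) (query k.+1 a t.+1).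
  rewrite query_pivot //; apply/windowP => u /pv hu.
  by clear -hu; lia.
have b2z z : z \in path T x -> block k (a + width k + 3) z ->
    beats T x F (a + width k + 3) z.
  rewrite /block => hz hzR; apply: (@beats_ancestor _ _ _ _ _ (block k.+1 a)) => //.
  - by apply: h2; rewrite widthS; clear -hzR; lia.
  - by clear -hzR; lia.
  - by apply: (window_block hF henc); rewrite /block widthS; clear -hzR; lia.
  - by apply: (follows_head _ hfol) => //; apply: query_block.
split=> [y hy|y hy|]; last by rewrite ht1.
- apply: gf_beat => // z hz hzb; rewrite /between => hbt.
  by have := pL z hz; have := pv z hz; rewrite /block; clear -hy hbt hzb; lia.
- apply: gf_beat => // z hz hzb; rewrite /between => hbt.
  apply: b2z => //; have := pv z hz; rewrite /block.
  by move: hy; rewrite widthS; clear -hbt hzb; lia.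
Qed.

(** Lower bound on the block's nodes on the GF path: the pivot comes with both buffers, and the
    residue [r.+1] is also the number of buffers met on the way into the left or right copy. *)
Fixpoint gf_rate (k t : nat) : nat :=
  if k is k'.+1 then
    if t %% 3 is r.+1 then gf_rate k' (t %/ 3) + r.+1 else 3
  else 1.

Fixpoint static_rate (k t : nat) : nat :=
  if k is k'.+1 then
    if t %% 3 is _.+1 then static_rate k' (t %/ 3) + 1 else 1
  else 1.

Lemma count_extra (p q : pred nat) P s : uniq P -> uniq s ->
  {subset s <= P} -> all (predD p q) s -> subpred q p ->
  count q P + size s <= count p P.
Proof.
move=> hP hs hsP /allP hsp hqp; rewrite -!size_filter addnC -size_cat.
apply: uniq_leq_size.
  rewrite cat_uniq hs filter_uniq // andbT; apply/hasPn => y.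
  by rewrite mem_filter => /andP[qy _]; apply/negP=> /hsp /=; rewrite qy.
move=> y; rewrite mem_cat !mem_filter => /orP[hy|/andP[/hqp -> ->]//].
by rewrite (hsP _ hy) andbT; have /andP[] := hsp _ hy.
Qed.

Lemma gf_is_bst_on n T x F : is_bst_on n T -> 0 < x <= n ->
  is_bst_on n (gf_step T x F).
Proof.
move=> hT hx; rewrite /is_bst_on inorder_gf_step ?(mem_bst_on _ hT) //.
exact: bst_is_bst_on hT.
Qed.

Lemma shielded_keep k a t T x F : bst T -> x \in inorder T ->
  (forall y, block k.+1 a y -> y \notin path T x) ->
  shielded k a t T -> shielded k a t (gf_step T x F).
Proof.
move=> hT hx hP [h1 h2 h3].
have b1 : a + width k + 1 \notin path T x.
  by apply: hP; rewrite /block widthS; lia.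
have b2 : a + width k + 3 \notin path T x.
  by apply: hP; rewrite /block widthS; lia.
by split=> *; apply: gf_keep => //; auto.
Qed.

(** The induction treats blocks that contain the query and blocks that miss it together, since a
    query to one copy leaves the other copy entirely off the path. Enclosure passes to the queried
    copy because the adjacent buffer is on the path. *)
Lemma invariant_step k a n t T (x : nat) (F : seq nat) :
  is_bst_on n T -> a + width k <= n -> {in F, forall y, 0 < y <= n} ->
  0 < x <= n -> follows k a t (x :: F) -> gf_invariant k a t (x :: F) T ->
  (if block k a x then enclosed k a n (path T x)
   else forall y, block k a y -> y \notin path T x) ->
  gf_invariant k a (if block k a x then t.+1 else t) F (gf_step T x F) /\
  (block k a x -> gf_rate k t <= count (block k a) (path T x)).
Proof.
move=> hT hn hF hxn; have hb := bst_is_bst_on hT.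
have hx : x \in inorder T by rewrite (mem_bst_on _ hT).
have hxx := path_self hb hx; have hu := path_uniq x hb.
elim: k a t hn => [|k IH] a t hn hfol hinv henc.
  split=> // hxb; rewrite -has_count; apply/hasP; by exists x.
have [hsh hiL hiR] := hinv.
have hfL := follows_left hfol; have hfR := follows_right hfol.
have hnL : a + width k <= n by move: hn; rewrite widthS; clear; lia.
have hnR : a + width k + 3 + width k <= n by move: hn; rewrite widthS; clear; lia.
have subL : subpred (block k a) (block k.+1 a).
  by move=> y; rewrite /block widthS; clear; lia.
have subR : subpred (block k (a + width k + 3)) (block k.+1 a).
  by move=> y; rewrite /block widthS; clear; lia.
have {}IHL := IH a _ hnL hfL hiL.
have {IH} IHR := IH (a + width k + 3) _ hnR hfR hiR.
have := follows_cons hfol; case: ifP henc hsh => hxb henc hsh; last first.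
  move=> _; split=> //.
  have nL : block k a x = false by apply: contraFF hxb; apply: subL.
  have nR : block k (a + width k + 3) x = false by apply: contraFF hxb; apply: subR.
  move: IHL IHR; rewrite nL nR => IHL IHR; split.
  - move=> hF'; apply: shielded_keep => //.
    by apply: hsh; rewrite /= hF' orbT.
  - by apply: (IHL _).1 => y /subL; apply: henc.
  - by apply: (IHR _).1 => y /subR; apply: henc.
case=> hq hfol'; have {}hsh : shielded k a t T by apply: hsh; rewrite /= hxb.
have bb1 : block k.+1 a (a + width k + 1) by rewrite /block widthS; clear; lia.
have bb2 : block k.+1 a (a + width k + 2) by rewrite /block widthS; clear; lia.
have bb3 : block k.+1 a (a + width k + 3) by rewrite /block widthS; clear; lia.
case: (mod3P t) => ht; rewrite /= ht.
- have hxq : x = a + width k + 2 by rewrite hq query_pivot.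
  clear hq; subst x.
  have nL : block k a (a + width k + 2) = false by rewrite /block; clear; lia.
  have nR : block k (a + width k + 3) (a + width k + 2) = false.
    by rewrite /block; clear; lia.
  have [p1 px p2 pL pR] := path_pivot hT hn hsh.
  move: IHL IHR; rewrite nL nR => /(_ pL)[IHL _] /(_ pR)[IHR _].
  split=> [|_].
    split.
    + by move=> hF'; apply: shielded_pivot hT hn hF henc hsh ht hfol' hF'.
    + by have -> : (t.+1 + 1) %/ 3 = (t + 1) %/ 3 by clear -ht; lia.
    + by have -> : t.+1 %/ 3 = t %/ 3 by clear -ht; lia.
  apply: leq_trans (@count_extra _ pred0 _
    [:: a + width k + 1; a + width k + 2; a + width k + 3] hu _ _ _ _) => //.
  + by rewrite count_pred0.
  + by rewrite /= !inE; clear; lia.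
  + by move=> y; rewrite !inE => /or3P[] /eqP ->.
  + by rewrite /= bb1 bb2 bb3.
- have hxL : block k a x by rewrite hq query_left // query_block.
  have nR : block k (a + width k + 3) x = false.
    by move: hxL; rewrite /block; clear; lia.
  have ht0 : t %% 3 != 0 by rewrite ht.
  have [p1 pR] := path_left hT hn hsh ht0 hxL.
  have encL : enclosed k a n (path T x).
    by split; [have [] := henc | right; rewrite -addn1].
  have {}pR y : block k (a + width k + 3) y -> y \notin path T x.
    by move=> hy; apply: pR; move: hy; rewrite /block widthS; clear; lia.
  move: IHL IHR; rewrite hxL nR => /(_ encL)[IHL hc] /(_ pR)[IHR _].
  split=> [|_].
    split.
    + by move=> hF'; apply: shielded_left hT hn hF henc hsh ht hxL hfol'.
    + by have -> : (t.+1 + 1) %/ 3 = ((t + 1) %/ 3).+1 by clear -ht; lia.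
    + by have -> : t.+1 %/ 3 = t %/ 3 by clear -ht; lia.
  (* At this residue the clock of the left copy agrees with the clock used by [gf_rate]. *)
  have et : (t + 1) %/ 3 = t %/ 3 by clear -ht; lia.
  rewrite et in hc.
  apply: leq_trans (@count_extra _ (block k a) _ [:: a + width k + 1] hu _ _ _ _) => //.
  + by rewrite leq_add2r; apply: hc.
  + by move=> y; rewrite inE => /eqP ->.
  + by rewrite /= bb1 andbT /block; clear; lia.
- have hxR : block k (a + width k + 3) x by rewrite hq query_right // query_block.
  have nL : block k a x = false.
    by move: hxR; rewrite /block; clear; lia.
  have ht0 : t %% 3 != 0 by rewrite ht.
  have [p1 p2 _ pL] := path_right hT hn hsh ht0 hxR.
  have encR : enclosed k (a + width k + 3) n (path T x).
    split; first by right.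
    (* The right copy ends where the whole block ends, so it inherits the right neighbour. *)
    have -> : a + width k + 3 + width k = a + width k.+1.
      by rewrite widthS; clear; lia.
    by have [] := henc.
  move: IHL IHR; rewrite nL hxR => /(_ pL)[IHL _] /(_ encR)[IHR hc].
  split=> [|_].
    split.
    + by move=> hF'; apply: shielded_right hT hn hF henc hsh ht hxR hfol'.
    + by have -> : (t.+1 + 1) %/ 3 = (t + 1) %/ 3 by clear -ht; lia.
    + by have -> : t.+1 %/ 3 = (t %/ 3).+1 by clear -ht; lia.
  apply: leq_trans (@count_extra _ (block k (a + width k + 3)) _
    [:: a + width k + 1; a + width k + 3] hu _ _ _ _) => //.
  + by rewrite leq_add2r; apply: hc.
  + by rewrite /= !inE; clear; lia.
  + by move=> y; rewrite !inE => /orP[] /eqP ->.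
  + by rewrite /= bb1 bb3 /block; clear; lia.
Qed.

(** At offset 0 the block is the whole key range, so it is enclosed without any neighbouring key and
    contains every query. *)
Lemma gf_cost_bound k t m T : is_bst_on (width k) T ->
  gf_invariant k 0 t (map (query k 0) (iota t m)) T ->
  \sum_(t <= i < t + m) gf_rate k i <= gf_cost T (map (query k 0) (iota t m)).
Proof.
elim: m t T => [|m IH] t T hT hinv; first by rewrite addn0 big_geq.
have hq i : 0 < query k 0 i <= width k by apply: query_block.
rewrite big_ltn ?addnS ?ltnS ?leq_addr // -addSn /=.
set F := map _ _.
have hF : {in F, forall y, 0 < y <= width k} by move=> y /mapP[i _ ->].
have hfol : follows k 0 t (query k 0 t :: F).
  exists m.+1; rewrite -[RHS]/(query k 0 t :: F); apply/all_filterP.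
  apply/allP => y; rewrite inE => /orP[/eqP ->|]; first exact: query_block.
  by case/mapP=> i _ ->; apply: query_block.
have hw : 0 + width k <= width k by [].
have := invariant_step hT hw hF (hq t) hfol hinv; rewrite query_block.
case; first by split; left.
move=> hinv' /(_ isT) hc; apply: leq_add.
  by apply: leq_trans hc _; apply: count_size.
by apply: IH => //; apply: gf_is_bst_on.
Qed.

(** Initial tree with the ancestor relations demanded by [shielded] at every level. *)
Fixpoint start_tree (k a : nat) : tree :=
  if k is k'.+1 then
    Node (start_tree k' a) (a + width k' + 1)
      (Node (Node Leaf (a + width k' + 2) Leaf) (a + width k' + 3)
         (start_tree k' (a + width k' + 3)))
  else Node Leaf a.+1 Leaf.

Lemma inorder_start_tree k a : inorder (start_tree k a) = iota a.+1 (width k).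
Proof.
elim: k a => [//|k IH] a.
have -> : width k.+1 = width k + (3 + width k) by rewrite widthS; clear; lia.
rewrite iotaD /= !IH.
have -> : a.+1 + width k = a + width k + 1 by clear; lia.
have -> : (a + width k + 1).+1 = a + width k + 2 by clear; lia.
by have -> : (a + width k + 2).+1 = a + width k + 3 by clear; lia.
Qed.

(** Asking only that [T] contain the ancestor relations of the block's start tree lets the induction
    descend to copies inside a larger tree. *)
Lemma invariant_start_tree k a F T :
  (forall y, block k a y -> {subset path (start_tree k a) y <= path T y}) ->
  gf_invariant k a 0 F T.
Proof.
elim: k a T => [//|k IH] a T hT /=; split.
- move=> _; split=> // y hy; apply: hT => /=.
  + by move: hy; rewrite /block widthS; clear; lia.
  + by rewrite mem_head.
  + by move: hy; rewrite /block widthS; clear; lia.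
  + rewrite inE; apply/orP; right.
    have -> : y < a + width k + 1 = false by move: hy; clear; lia.
    have -> : a + width k + 1 < y by move: hy; clear; lia.
    by rewrite mem_head.
- apply: IH => y hy z hz; apply: hT.
    by move: hy; rewrite /block widthS; clear; lia.
  have yl : y < a + width k + 1 by move: hy; rewrite /block; clear; lia.
  by rewrite path_node_lt // inE hz orbT.
- apply: IH => y hy z hz; apply: hT.
    by move: hy; rewrite /block widthS; clear; lia.
  have yl : a + width k + 1 < y by move: hy; rewrite /block; clear; lia.
  have yl' : a + width k + 3 < y by move: hy; rewrite /block; clear; lia.
  by rewrite path_node_gt // path_node_gt // !inE hz !orbT.
Qed.

(** * The static competitor *)

(** The arguments [l] and [r] are hung at the two ends of the block; through them each buffer is
    handed down the adjacent copy to the bottom. *)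
Fixpoint static_tree (k a : nat) (l r : tree) : tree :=
  if k is k'.+1 then
    Node (static_tree k' a l (Node Leaf (a + width k' + 1) Leaf))
      (a + width k' + 2)
      (static_tree k' (a + width k' + 3) (Node Leaf (a + width k' + 3) Leaf) r)
  else Node l a.+1 r.

Lemma inorder_static_tree k a l r :
  inorder (static_tree k a l r) = inorder l ++ iota a.+1 (width k) ++ inorder r.
Proof.
elim: k a l r => [//|k IH] a l r.
have -> : width k.+1 = width k + (3 + width k) by rewrite widthS; clear; lia.
rewrite iotaD /= !IH /=.
have -> : a.+1 + width k = a + width k + 1 by clear; lia.
have -> : (a + width k + 1).+1 = a + width k + 2 by clear; lia.
have -> : (a + width k + 2).+1 = a + width k + 3 by clear; lia.
by rewrite -!catA.
Qed.

Lemma size_path_static_tree k a l r t :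
  size (path (static_tree k a l r) (query k a t)) = static_rate k t.
Proof.
elim: k a l r t => [|k IH] a l r t; first by rewrite /= ltnn.
case: (mod3P t) => ht.
- by rewrite query_pivot // [LHS]/= ltnn /= ht.
- rewrite query_left // [static_tree _ _ _ _]/= path_node_lt; last first.
    by have := query_block k a (t %/ 3); rewrite /block; clear; lia.
  by rewrite [LHS]/= IH /= ht addn1.
- rewrite query_right // [static_tree _ _ _ _]/= path_node_gt; last first.
    have := query_block k (a + width k + 3) (t %/ 3); rewrite /block.
    by clear; lia.
  by rewrite [LHS]/= IH /= ht addn1.
Qed.

(** * Rotations connect all search trees on the same keys *)

Lemma rot_inorder c T T' : rot c T = Some T' -> inorder T' = inorder T.
Proof.
elim: T T' => //= l IHl k r IHr T'.
case: ifP => _.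
  case: l IHl => // a lk b IHl; case: ifP => _.
    by case=> <-; rewrite /= -catA.
  by case E: (rot c _) => [l'|] //= [<-] /=; rewrite (IHl _ E).
case: ifP => // _; case: r IHr => // a rk b IHr; case: ifP => _.
  by case=> <-; rewrite /= -catA.
by case E: (rot c _) => [r'|] //= [<-] /=; rewrite (IHr _ E).
Qed.

Lemma rot_mem c T T' : rot c T = Some T' ->
  c \in inorder T /\ forall l k r, T = Node l k r -> k != c.
Proof.
elim: T T' => //= l IHl k r IHr T' h.
suff [hc hk] : c \in inorder l ++ k :: inorder r /\ k != c.
  by split=> // l0 k0 r0 [_ <- _].
rewrite mem_cat inE; move: h; case: ltngtP => // ck.
- case: l IHl => // a lk b IHl; case: (eqVneq lk c) => [<-|_].
    by rewrite /= mem_cat mem_head orbT.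
  by case E: (rot c _) => [l'|] // _; have [-> _] := IHl _ E.
- case: r IHr => // a rk b IHr; case: (eqVneq rk c) => [<-|_].
    by rewrite /= !mem_cat mem_head !orbT.
  by case E: (rot c _) => [r'|] // _; have [-> _] := IHr _ E; rewrite !orbT.
Qed.

Definition rotates_to (T T' : tree) : Prop :=
  exists rs E, run_rots T rs = Some (T', E).

Lemma rotates_refl T : rotates_to T T.
Proof. by exists [::], [::]. Qed.

Lemma rotates_trans T1 T2 T3 :
  rotates_to T1 T2 -> rotates_to T2 T3 -> rotates_to T1 T3.
Proof.
case=> rs1 [E1 h1] [rs2 [E2 h2]]; exists (rs1 ++ rs2).
elim: rs1 T1 E1 h1 => [|c rs IH] T E /=; first by case=> -> _; exists E2.
case: (rot c T) => // T'; case E': (run_rots T' rs) => [[T'' E'']|] // [hT _].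
rewrite hT in E'; have [E3 ->] := IH _ _ E'.
by eexists.
Qed.

Lemma rotates_rot c T T' : rot c T = Some T' -> rotates_to T T'.
Proof. by move=> h; exists [:: c]; rewrite /= h; eexists. Qed.

Lemma rotates_inorder T T' : rotates_to T T' -> inorder T' = inorder T.
Proof.
case=> rs [E]; elim: rs T E => [|c rs IH] T E /=; first by case=> <-.
case h: (rot c T) => [T1|] //; case h1: (run_rots T1 rs) => [[T2 E2]|] // [e _].
by rewrite e in h1; rewrite (IH _ _ h1) (rot_inorder h).
Qed.

(** Only rotations of trees with the in-order sequence of [T] have to be checked, so bounds on the
    keys of [T] remain available at every step. *)
Lemma rotates_ind (R : tree -> tree -> Prop) :
  (forall T, R T T) ->
  (forall T1 T2 T3, R T1 T2 -> R T2 T3 -> R T1 T3) ->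
  forall T T', (forall c T1 T2, inorder T1 = inorder T -> rot c T1 = Some T2 ->
    R T1 T2) -> rotates_to T T' -> R T T'.
Proof.
move=> hr ht T T' hs [rs [E]]; elim: rs T E hs => [|c rs IH] T E hs /=.
  by case=> <-.
case h: (rot c T) => [T1|] //; case h1: (run_rots T1 rs) => [[T2 E2]|] // [e _].
rewrite e in h1; apply: ht (hs _ _ _ erefl h) _; apply: IH h1 => c' T3 T4 h3.
by apply: hs; rewrite h3 (rot_inorder h).
Qed.

Lemma rotates_left l l' k r : (forall z, z \in inorder l -> z < k) ->
  rotates_to l l' -> rotates_to (Node l k r) (Node l' k r).
Proof.
move=> hk; apply: (@rotates_ind (fun l l' => rotates_to (Node l k r) (Node l' k r))).
- by move=> T; apply: rotates_refl.
- by move=> T1 T2 T3; apply: rotates_trans.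
move=> c T1 T2 h1 h; apply: (@rotates_rot c).
have [hc hroot] := rot_mem h; rewrite h1 in hc.
rewrite /= (hk _ hc); case: T1 h hroot {h1} => // a lk b h hroot.
by rewrite (negPf (hroot _ _ _ erefl)) h.
Qed.

Lemma rotates_right l k r r' : (forall z, z \in inorder r -> k < z) ->
  rotates_to r r' -> rotates_to (Node l k r) (Node l k r').
Proof.
move=> hk; apply: (@rotates_ind (fun r r' => rotates_to (Node l k r) (Node l k r'))).
- by move=> T; apply: rotates_refl.
- by move=> T1 T2 T3; apply: rotates_trans.
move=> c T1 T2 h1 h; apply: (@rotates_rot c).
have [hc hroot] := rot_mem h; rewrite h1 in hc; have kc := hk _ hc.
rewrite /= kc ltnNge (ltnW kc) /=; case: T1 h hroot {h1} => // a rk b h hroot.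
by rewrite (negPf (hroot _ _ _ erefl)) h.
Qed.

(** Bring [k] to the root of its side recursively, then rotate it once over the root. *)
Lemma rotates_root T k : bst T -> k \in inorder T ->
  exists l r, rotates_to T (Node l k r).
Proof.
elim: T => // l IHl k0 r IHr hb; have [hl hr al ar] := bst_nodeP hb.
rewrite inorder_node //; case: (ltngtP k k0) => [kk|kk|->] hk.
- have [l1 [r1 h]] := IHl hl hk; exists l1, (Node r1 k0 r).
  apply: rotates_trans (rotates_left r al h) _.
  by apply: (@rotates_rot k); rewrite /= kk eqxx.
- have [l1 [r1 h]] := IHr hr hk; exists (Node l k0 l1), r1.
  apply: rotates_trans (rotates_right l ar h) _.
  by apply: (@rotates_rot k); rewrite /= ltnNge (ltnW kk) /= kk eqxx.
- by exists l, r; apply: rotates_refl.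
Qed.

Lemma inorder_children l k r : bst (Node l k r) ->
  inorder l = filter (ltn^~ k) (inorder (Node l k r)) /\
  inorder r = filter (ltn k) (inorder (Node l k r)).
Proof.
move=> hb; have [hl hr al ar] := bst_nodeP hb.
rewrite /= !filter_cat /= ltnn; split.
- rewrite (@eq_in_filter _ (ltn^~ k) predT) ?filter_predT; last by move=> z /al.
  rewrite (@eq_in_filter _ (ltn^~ k) pred0) ?filter_pred0 ?cats0 //.
  by move=> z /ar /=; lia.
- rewrite (@eq_in_filter _ (ltn k) pred0) ?filter_pred0; last first.
    by move=> z /al /=; lia.
  by rewrite (@eq_in_filter _ (ltn k) predT) ?filter_predT // => z /ar.
Qed.

(** Rotate the root of [T'] to the top of [T]; the in-order sequences then agree on each side, and
    both subtrees are transformed recursively. *)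
Lemma rotates_total T T' : bst T -> inorder T = inorder T' -> rotates_to T T'.
Proof.
elim: T' T => [|l' IHl k r' IHr] T hb hT.
  case: T hb hT => [|l k r] _ hT; first exact: rotates_refl.
  by move/(congr1 size): hT; rewrite /= size_cat addnS.
have [|l [r h]] := @rotates_root T k hb.
  by rewrite hT /= mem_cat mem_head orbT.
have hi : inorder (Node l k r) = inorder (Node l' k r').
  by rewrite (rotates_inorder h).
have hb1 : bst (Node l k r) by rewrite /bst (rotates_inorder h).
have hb2 : bst (Node l' k r') by rewrite /bst -hT.
have [e1 e2] := inorder_children hb1; have [e3 e4] := inorder_children hb2.
have [hl hr al ar] := bst_nodeP hb1.
have el : inorder l = inorder l' by rewrite e1 e3 hi.
have er : inorder r = inorder r' by rewrite e2 e4 hi.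
apply: rotates_trans h (rotates_trans (rotates_left r al (IHl _ hl el)) _).
exact: rotates_right ar (IHr _ hr er).
Qed.

Lemma static_schedule T X : exists2 c,
  sched_cost T X (nseq (size X) [::]) = Some c
  & c <= \sum_(x <- X) size (path T x).
Proof.
elim: X => [|x X [c h hc]]; first by exists 0.
exists (step_cost T x [::] + c); first by rewrite /= h.
rewrite big_cons leq_add // /step_cost /hull /= cats0.
exact: size_undup.
Qed.

Lemma opt_le_static T T' x : bst T -> inorder T = inorder T' ->
  exists C, forall X k, is_opt_cost T (x :: X) k ->
    k <= C + \sum_(y <- X) size (path T' y).
Proof.
move=> hb hT; have [rs [E hrs]] := rotates_total hb hT.
(* All rotations are made at the first query; their cost is fixed before the later queries [X]
   are. *)
exists (step_cost T x E) => X k [_ hk].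
have [c hc hle] := static_schedule T' X.
apply: leq_trans (hk (rs :: nseq (size X) [::]) (step_cost T x E + c) _) _.
  by rewrite /= hrs hc.
by rewrite leq_add2l.
Qed.

(** Descent on the cost, starting from the schedule without rotations. *)
Lemma opt_exists T X : exists k, is_opt_cost T X k.
Proof.
have [c hc _] := static_schedule T X.
elim/ltn_ind: c (nseq _ _) hc => c IH S hS.
case: (classic (exists S' c', sched_cost T X S' = Some c' /\ c' < c)).
  by case=> S' [c' [hS' lt_c'c]]; apply: IH lt_c'c _ hS'.
move=> hmin; exists c; split; first by exists S.
move=> S' c' hS'; rewrite leqNgt; apply/negP => lt_c'c.
by apply: hmin; exists S', c'.
Qed.

(** * Summing the rates *)

Lemma sum_by_three (f : nat -> nat) n :
  \sum_(0 <= i < 3 * n) f i =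
  \sum_(0 <= j < n) (f (3 * j) + f (3 * j + 1) + f (3 * j + 2)).
Proof.
elim: n => [|n IH]; first by rewrite !big_geq.
have -> : 3 * n.+1 = (3 * n).+3 by clear; lia.
rewrite !(big_nat_recr, IH) //= addn1 addn2; lia.
Qed.

(** If the copies have rates [g] and [s] at a given local time, a round of three sums to [2 * g + 6]
    for GF and [2 * s + 3] for the static tree. So the deficit [2 * s - g] only doubles per level,
    while the number of queries triples. *)
Lemma rate_sum k p :
  2 * (\sum_(0 <= i < expn 3 k * p) static_rate k i) =
  \sum_(0 <= i < expn 3 k * p) gf_rate k i + expn 2 k * p.
Proof.
elim: k p => [|k IH] p.
  by rewrite /= !sum_nat_const_nat; lia.
rewrite expnS -mulnA !sum_by_three.
have e r j : r < 3 -> (3 * j + r) %% 3 = r /\ (3 * j + r) %/ 3 = j by lia.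
under eq_bigr => j _.
  have [m0 _] := e 0 j isT; have [m1 d1] := e 1 j isT; have [m2 d2] := e 2 j isT.
  rewrite addn0 in m0; rewrite /= m0 m1 d1 m2 d2.
  over.
under [X in _ = X + _]eq_bigr => j _.
  have [m0 _] := e 0 j isT; have [m1 d1] := e 1 j isT; have [m2 d2] := e 2 j isT.
  rewrite addn0 in m0; rewrite /= m0 m1 d1 m2 d2.
  over.
rewrite !big_split /= !sum_nat_const_nat expnS -mulnA.
have := IH p; lia.
Qed.

Lemma static_rate_gt0 k t : 0 < static_rate k t.
Proof. by case: k => //= k; case: (t %% 3) => // r; rewrite addn1. Qed.

Lemma static_sum_ge k m : m <= \sum_(0 <= i < m) static_rate k i.
Proof.
rewrite -[m in m <= _]muln1 -{1}[m]subn0 -sum_nat_const_nat.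
by apply: leq_sum => i _; apply: static_rate_gt0.
Qed.

(** * The competitive ratio *)

Definition queries (k m : nat) : seq nat := map (query k 0) (iota 0 m).

Lemma start_tree_bst k : is_bst_on (width k) (start_tree k 0).
Proof. by rewrite /is_bst_on inorder_start_tree. Qed.

Lemma gf_vs_opt k : exists C, forall p, 0 < p -> exists S,
  [/\ expn 3 k * p <= S,
      forall o, is_opt_cost (start_tree k 0) (queries k (expn 3 k * p)) o ->
        o <= C + S
    & 2 * S <= gf_cost (start_tree k 0) (queries k (expn 3 k * p)) + expn 2 k * p].
Proof.
have hT := start_tree_bst k.
have hs : inorder (start_tree k 0) = inorder (static_tree k 0 Leaf Leaf).
  by rewrite inorder_static_tree inorder_start_tree /= cats0.
have [C hC] := opt_le_static (query k 0 0) (bst_is_bst_on hT) hs.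
exists C => p p_gt0; set m := expn 3 k * p.
have m_gt0 : 0 < m by rewrite muln_gt0 expn_gt0.
exists (\sum_(0 <= i < m) static_rate k i); split.
- exact: static_sum_ge.
- move=> o; rewrite /queries; case: m m_gt0 => // m _ /hC ho.
  apply: leq_trans ho _; rewrite leq_add2l big_map big_ltn //.
  rewrite /index_iota subSS subn0.
  (* The first query is already paid for in [C], so its static rate is dropped. *)
  apply: leq_trans (leq_addl _ _).
  by apply: leq_sum => i _; rewrite size_path_static_tree.
- rewrite rate_sum leq_add2r; have := @gf_cost_bound k 0 m _ hT; rewrite add0n.
  by apply; apply: invariant_start_tree => y _.
Qed.

Lemma INR_addn m n : INR (m + n) = (INR m + INR n)%R.
Proof. by rewrite -plusE plus_INR. Qed.

Lemma INR_muln m n : INR (m * n) = (INR m * INR n)%R.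
Proof. by rewrite -multE mult_INR. Qed.

Lemma INR_leq m n : m <= n -> (INR m <= INR n)%R.
Proof. by move=> /leP; apply: le_INR. Qed.

Lemma INR_expn m n : INR (expn m n) = pow (INR m) n.
Proof. by elim: n => [|n IH] //; rewrite expnS INR_muln IH. Qed.

Lemma two_thirds_small e : (0 < e)%R ->
  exists k, (INR (expn 2 k) < e * INR (expn 3 k))%R.
Proof.
move=> he; have [|k hk] := pow_lt_1_zero (2 / 3)%R _ e he.
  by rewrite Rabs_right; lra.
exists k; have := hk k (le_n k); rewrite !INR_expn.
have h3 : (0 < pow (INR 3) k)%R by apply: pow_lt; rewrite /=; lra.
have -> : (2 / 3 = INR 2 * / INR 3)%R by rewrite /=; lra.
rewrite Rpow_mult_distr pow_inv => h.
have := Rle_lt_trans _ _ _ (Rle_abs _) h => {}h.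
by have := Rmult_lt_compat_r _ _ _ h3 h; rewrite Rmult_assoc Rinv_l; lra.
Qed.

Theorem theorem1 (c : R) (d : nat -> nat -> R) :
  (forall n : nat, Un_cv (fun m : nat => (d n m / INR m)%R) 0%R) ->
  (forall (n m : nat) (T0 : tree) (X : seq nat) (k : nat),
      is_bst_on n T0 ->
      size X = m ->
      all (fun x => (1 <= x <= n)%N) X ->
      is_opt_cost T0 X k ->
      (INR (gf_cost T0 X) <= c * INR k + d n m)%R) ->
  (2 <= c)%R.
Proof.
move=> hd hc; case: (Rle_lt_dec 2 c) => // c_lt2; exfalso.
(* Replacing [c] by a nonnegative bound makes multiplication by it monotone. *)
pose c' := Rmax c 0; pose e := (2 - c')%R.
have c'_ge0 : (0 <= c')%R by apply: Rmax_r.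
have c'_ge : (c <= c')%R by apply: Rmax_l.
have c'_lt2 : (c' < 2)%R by apply: Rmax_lub_lt; lra.
have he : (0 < e)%R by rewrite /e; lra.
have [k hk] : exists k, (INR (expn 2 k) < e / 2 * INR (expn 3 k))%R.
  by apply: two_thirds_small; lra.
have [C hC] := gf_vs_opt k.
have he8 : (e / 8 > 0)%R by lra.
have [N hN] := hd (width k) (e / 8)%R he8.
have [q hq] := INR_unbounded (c' * INR C / (e / 8)).
(* Since [m] is at least [p], this makes both [d (width k) m] and [c' * INR C] at most
   [e / 8 * INR m]. *)
pose p := (N + q).+1; pose m := expn 3 k * p.
have [S [hmS ho hS]] := hC p isT; rewrite -/m in hmS ho hS.
have [o hopt] := opt_exists (start_tree k 0) (queries k m).
have hm : p <= m by rewrite leq_pmull // expn_gt0.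
have := hc (width k) m _ _ o (start_tree_bst k) _ _ hopt.
rewrite size_map size_iota => /(_ erefl).
have -> : all (fun x => 1 <= x <= width k) (queries k m).
  by apply/allP => _ /mapP[i _ ->]; apply: query_block.
move=> /(_ isT) hg.
have {}ho := INR_leq (ho _ hopt); rewrite INR_addn in ho.
have {}hS := INR_leq hS; rewrite INR_addn !INR_muln in hS.
have {}hmS := INR_leq hmS.
have p_gt0 : (0 < INR p)%R by apply: lt_0_INR; apply/ltP.
have hmR : (INR p <= INR m)%R by apply: INR_leq.
have hqm : (INR q <= INR m)%R.
  by apply: Rle_trans hmR; apply: INR_leq; rewrite /p; lia.
have := hN m; rewrite /Rdist Rminus_0_r => /(_ _) hdm.
have {}hdm : (d (width k) m < e / 8 * INR m)%R.
  have hlt : (Rabs (d (width k) m / INR m) < e / 8)%R.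
    by apply: hdm; apply/leP; apply: leq_trans hm; rewrite /p; lia.
  have := Rle_lt_trans _ _ _ (Rle_abs _) hlt => {}hlt.
  have m0 : (0 < INR m)%R by lra.
  have := Rmult_lt_compat_r _ _ _ m0 hlt.
  by rewrite /Rdiv Rmult_assoc Rinv_l; lra.
have hCm : (c' * INR C <= e / 8 * INR m)%R.
  have h : (c' * INR C < INR q * (e / 8))%R.
    have := Rmult_lt_compat_r _ _ _ he8 hq.
    by rewrite {1}/Rdiv Rmult_assoc Rinv_l; lra.
  by have := Rmult_le_compat_r _ _ _ (Rlt_le _ _ he8) hqm; lra.
have hko : (c * INR o <= c' * (INR C + INR S))%R.
  apply: (Rle_trans _ (c' * INR o)%R).
    by apply: Rmult_le_compat_r => //; apply: pos_INR.
  by apply: Rmult_le_compat_l.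
have hmE : INR m = (INR (expn 3 k) * INR p)%R by rewrite /m INR_muln.
have hkp : (INR (expn 2 k) * INR p < e / 2 * INR m)%R.
  by rewrite hmE -Rmult_assoc; apply: Rmult_lt_compat_r.
have heS : (e * INR m <= e * INR S)%R by apply: Rmult_le_compat_l; lra.
have hexp : (e * INR S = 2 * INR S - c' * INR S)%R by rewrite /e; ring.
(* The error terms add up to less than [(1/8 + 1/8 + 1/2) * e * INR m], whereas [e * INR S] is at
   least [e * INR m]. *)
have := hS; rewrite [INR 2]/=.
have m0 : (0 < INR m)%R by lra.
have : (0 < e * INR m)%R by apply: Rmult_lt_0_compat.
lra.
Qed.
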